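(* Every finite solvable SST-group $G$ is a BT-group.
   Context: All groups are finite. Two subgroups $A,B$ of a group permute if $AB=BA$. A supplement of $H$ in $G$ is a subgroup $K\le G$ with $G=HK$. A subgroup $H$ of a group $G$ is SS-permutable in $G$ if $H$ has a supplement $K$ in $G$ such that $H$ permutes with every Sylow subgroup of $K$ (for all primes). $G$ is an SST-group if SS-permutability is transitive: whenever $H\le K\le G$, $H$ is SS-permutable in $K$ and $K$ is SS-permutable in $G$, then $H$ is SS-permutable in $G$. A subgroup $H$ of $G$ is semipermutable in $G$ if $H$ permutes with every subgroup $X$ of $G$ such that $(|H|,|X|)=1$. $G$ is a BT-group if semipermutability is transitive: whenever $H\le K\le G$, $H$ is semipermutable in $K$ and $K$ is semipermutable in $G$, then $H$ is semipermutable in $G$. *)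

(* Defs.v *)
From mathcomp Require Import all_boot all_fingroup all_solvable.

Set Implicit Arguments.
Unset Strict Implicit.
Unset Printing Implicit Defensive.

Local Open Scope group_scope.

Section Permutability.

Variable gT : finGroupType.
Implicit Types A B G H K P X : {group gT}.

(* Equality of product sets: AB = BA, not elementwise commutation. *)
Definition permutes A B : Prop := A * B = B * A.

Definition supplement G H K : Prop := K \subset G /\ G = H * K :> {set gT}.

Definition SSpermutable G H : Prop :=
  H \subset G /\
  exists2 K : {group gT}, supplement G H K &
    forall (p : nat) (P : {group gT}),
      prime p -> p.-Sylow(K) P -> permutes H P.

Definition SST_group G : Prop :=
  forall H K : {group gT}, H \subset K -> K \subset G ->
    SSpermutable K H -> SSpermutable G K -> SSpermutable G H.

Definition semipermutable G H : Prop :=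
  H \subset G /\
  forall X : {group gT}, X \subset G -> coprime #|H| #|X| -> permutes H X.

Definition BT_group G : Prop :=
  forall H K : {group gT}, H \subset K -> K \subset G ->
    semipermutable K H -> semipermutable G K -> semipermutable G H.

End Permutability.

(* Main.v *)
Require Import Defs.
From mathcomp Require Import all_boot all_fingroup all_solvable.

Set Implicit Arguments.
Unset Strict Implicit.
Unset Printing Implicit Defensive.

Local Open Scope group_scope.

(** In a finite solvable group [G] with transitive SS-permutability every
    subgroup turns out to be semipermutable, which makes transitivity of
    semipermutability immediate.

    The first point is that the derived subgroup of [G] is nilpotent
    ([solvable_SST_der1_nil]). Let [N] be a minimal normal subgroup, an
    elementary abelian [p]-group, and let [x] in [N] be an element of order [p]
    central in a Sylow [p]-subgroup of [G]. As [<[x]> <| N <| G], transitivity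
    makes [<[x]>] SS-permutable in [G]; hence it permutes with every Sylow
    [q]-subgroup [Q] for [q != p], and [<[x]> = <[x]> * Q :&: N] is normalised
    by [Q]. So [<[x]>] is normal in [G] and [N = <[x]>] is cyclic, whence
    [G^`(1)] centralises [N]. The hypotheses pass to [G / N], and induction on
    the order shows that [G^`(1)] is nilpotent.

    The second point is that every subgroup [A] is then SS-permutable
    ([SST_SSpermutable]): [A] is SS-permutable in [A <*> G^`(1)], where
    the nilpotent group [G^`(1)] is a supplement all of whose Sylow subgroups
    are normal, and [A <*> G^`(1)] is normal in [G].

    Finally, if all subgroups are SS-permutable then [p]-subgroups permute with
    [q]-subgroups for [p != q] ([permutes_prime_power]), and subgroups of
    coprime orders permute because their Sylow subgroups do. *)

(** * Permuting subgroups *)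

Section Permuting.

Variable gT : finGroupType.
Implicit Types A B G H K L N P Q X : {group gT}.

Lemma permutes_sub A B : A * B \subset B * A -> permutes A B.
Proof.
move=> sABBA; apply/eqP; rewrite eqEsubset sABBA -invSg !invMg !invGid.
exact: sABBA.
Qed.

Lemma permutes_norm A B : A \subset 'N(B) -> permutes A B.
Proof. exact: normC. Qed.

Lemma subset_by_Sylow G A :
    (forall p, prime p -> exists2 P : {group gT}, p.-Sylow(G) P & P \subset A) ->
  G \subset A.
Proof.
move=> sylA; apply/setIidPl/eqP; rewrite eqEcard subsetIl dvdn_leq //.
apply/dvdn_partP=> // p; rewrite mem_primes => /and3P[p_pr _ _].
have [P sylP sPA] := sylA p p_pr.
by rewrite -(card_Hall sylP) cardSg // subsetI (pHall_sub sylP).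
Qed.

(** The elements [g] of [A] with [g X] inside [X A] are closed under products,
    hence form a subgroup; it contains each Sylow subgroup of [A] and is
    therefore equal to [A]. *)
Lemma permutes_by_Sylow A X :
    (forall p P, prime p -> p.-Sylow(A) P -> permutes P X) -> permutes A X.
Proof.
move=> permX; apply: permutes_sub.
pose T := [set g in A | [set g] * X \subset X * A].
have groupT : group_set T.
  apply/group_setP; split=> [|g h].
    by rewrite inE group1 mul1g -{1}[X : {set gT}]mulg1 mulgS ?sub1G.
  rewrite !inE => /andP[Ag sg] /andP[Ah sh]; rewrite groupM //= -mulg_set1.
  rewrite -mulgA (subset_trans (mulgS _ sh)) // mulgA.
  by rewrite (subset_trans (mulSg _ sg)) // -mulgA mulGid.
have sAT : A \subset Group groupT.
  apply: subset_by_Sylow => p p_pr.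
  have [P sylP] := Sylow_exists p A; exists P => //.
  apply/subsetP=> g Pg; rewrite inE (subsetP (pHall_sub sylP)) //=.
  apply: (@subset_trans _ _ (P * X)); first by rewrite mulSg ?sub1set.
  by rewrite (permX p P) // mulgS ?(pHall_sub sylP).
apply/subsetP=> _ /mulsgP[a x Aa Xx ->].
have /setIdP[_ /subsetP] := subsetP sAT a Aa.
by apply; rewrite mem_mulg ?set11.
Qed.

(** * Basic properties of SS-permutability *)

Lemma SSpermutable_normal G N : N <| G -> SSpermutable G N.
Proof.
case/andP=> sNG nNG; split=> //; exists G => [|p P _ sylP].
  by split=> //; rewrite mulSGid.
apply/esym/permutes_norm; exact: subset_trans (pHall_sub sylP) nNG.
Qed.

Lemma SSpermutable_subgroup G H L :
  H \subset L -> L \subset G -> SSpermutable G H -> SSpermutable L H.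
Proof.
move=> sHL sLG [_ [K [sKG defG] permK]]; split=> //.
exists (K :&: L)%G => [|p P p_pr sylP].
  split; first exact: subsetIr.
  by rewrite group_modl // -defG (setIidPr sLG).
have [sPKL pP _] := and3P sylP; rewrite subsetI in sPKL.
have [sPK sPL] := andP sPKL.
have [S sylS sPS] := Sylow_superset sPK pP.
have defP : P :=: S :&: L.
  apply/esym/(sub_pHall sylP).
  - exact: pgroupS (subsetIl _ _) (pHall_pgroup sylS).
  - by rewrite subsetI sPS.
  - by rewrite setSI // (pHall_sub sylS).
have permS : H * S = S * H := permK p S p_pr sylS.
rewrite /permutes defP group_modl // permS.
by rewrite (setIC S) group_modr // setIC.
Qed.

(** When [p] does not divide [#|H|], every Sylow [p]-subgroup of [G = H * K] is
    conjugate under [H] to a Sylow [p]-subgroup of the supplement [K], so that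
    the defining property extends from [K] to [G]. *)
Lemma SSpermutable_Sylow G H p P :
    SSpermutable G H -> prime p -> p^'.-group H -> p.-Sylow(G) P ->
  permutes H P.
Proof.
move=> [sHG [K [sKG defG] permK]] p_pr p'H sylP.
have [Q sylQ] := Sylow_exists p K.
have sylQG : p.-Sylow(G) Q.
  rewrite pHallE (subset_trans (pHall_sub sylQ)) //=.
  rewrite (card_Hall sylQ) eqn_dvd partn_dvd ?cardSg //=.
  have dvG : #|G| %| #|H| * #|K| by rewrite defG mul_cardG dvdn_mulr.
  apply: dvdn_trans (partn_dvd p _ dvG) _; first by rewrite muln_gt0 !cardG_gt0.
  by rewrite partnM // part_p'nat // mul1n.
have [x] := Sylow_trans sylQG sylP.
rewrite -groupV defG => /mulsgP[h k Hh Kk defx] defP.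
have {}defP : P = (Q :^ k^-1) :^ h^-1 :> {set gT}.
  by rewrite defP -[x]invgK defx invMg conjsgM.
have sylQk : p.-Sylow(K) (Q :^ k^-1) by rewrite pHallJ ?groupV.
have permQ : H * Q :^ k^-1 = Q :^ k^-1 * H := permK p _%G p_pr sylQk.
have defH : H = H :^ h^-1 :> {set gT} by rewrite conjGid ?groupV.
by rewrite /permutes defP defH -!conjsMg permQ.
Qed.

(** The supplement is [N]: its Sylow subgroups are characteristic in [N], hence
    normal in [G], so they permute with everything. *)
Lemma SSpermutable_join_nil G N A :
    nilpotent N -> N <| G -> A \subset G -> SSpermutable (A <*> N) A.
Proof.
move=> nilN nNG sAG; split; first exact: joing_subl.
have nNA := subset_trans sAG (normal_norm nNG).
exists N => [|p P p_pr sylP].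
  by split; [apply: joing_subr | apply: norm_joinEl].
apply: permutes_norm; rewrite (nilpotent_Hall_pcore nilN sylP).
apply: subset_trans sAG (normal_norm _).
exact: char_normal_trans (pcore_char p N) nNG.
Qed.

Lemma SST_SSpermutable G A :
    SST_group G -> nilpotent G^`(1) -> A \subset G -> SSpermutable G A.
Proof.
move=> SST_G nilG' sAG.
have sJG : A <*> G^`(1) \subset G by rewrite join_subG sAG der_sub.
apply: (SST_G A (A <*> G^`(1))%G) => //; first exact: joing_subl.
  exact: SSpermutable_join_nil (der_normal 1 G) sAG.
exact/SSpermutable_normal/sub_der1_normal/sJG/joing_subr.
Qed.

(** If every subgroup is SS-permutable then a [p]-subgroup and a [q]-subgroup
    permute: [A] permutes with a Sylow [q]-subgroup [S] containing [B], and then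
    [B], being SS-permutable in [A * S], permutes with [A], which is a Sylow
    [p]-subgroup of [A * S]. *)
Lemma permutes_prime_power G p q A B :
    (forall H, H \subset G -> SSpermutable G H) ->
    prime p -> prime q -> p != q -> p.-group A -> q.-group B ->
    A \subset G -> B \subset G ->
  permutes A B.
Proof.
move=> allSS p_pr q_pr neq_pq pA qB sAG sBG.
have [S sylS sBS] := Sylow_superset sBG qB.
have [sSG qS _] := and3P sylS.
have q'A : q^'.-group A by apply: pi_pnat pA _; rewrite !inE.
have p'S : p^'.-group S by apply: pi_pnat qS _; rewrite !inE eq_sym.
have permAS : permutes A S := SSpermutable_Sylow (allSS A sAG) q_pr q'A sylS.
pose L := (A <*> S)%G.
have defL : L = A * S :> {set gT} by rewrite /= comm_joingE.
have sLG : L \subset G by rewrite join_subG sAG.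
have sylA : p.-Sylow(L) A.
  rewrite pHallE joing_subl /= -/L defL coprime_cardMg ?partnM //.
    by rewrite part_pnat_id // part_p'nat // muln1.
  exact: pnat_coprime pA p'S.
apply/esym; apply: SSpermutable_Sylow p_pr (pgroupS sBS p'S) sylA.
apply: SSpermutable_subgroup sLG (allSS B sBG).
exact: subset_trans sBS (joing_subr _ _).
Qed.

Lemma coprime_permutes G A X :
    (forall H, H \subset G -> SSpermutable G H) ->
    A \subset G -> X \subset G -> coprime #|A| #|X| ->
  permutes A X.
Proof.
move=> allSS sAG sXG coAX.
apply: permutes_by_Sylow => p P p_pr sylP; apply/esym.
apply: permutes_by_Sylow => q Q q_pr sylQ.
have [sPA pP _] := and3P sylP; have [sQX qQ _] := and3P sylQ.
have sPG := subset_trans sPA sAG; have sQG := subset_trans sQX sXG.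
have [eq_qp | neq_qp] := eqVneq q p; last first.
  exact: permutes_prime_power allSS q_pr p_pr neq_qp qQ pP sQG sPG.
(* P and Q are p-groups of coprime orders, so one of them is trivial. *)
rewrite eq_qp in qQ; have [P1 | ntP] := eqsVneq P 1.
  by rewrite /permutes P1 mulg1 mul1g.
have coPQ : coprime #|P| #|Q| := coprimeSg sPA (coprimegS sQX coAX).
have [_ p_dvP _] := pgroup_pdiv pP ntP.
have p'Q : p^'.-group Q 
  by rewrite /pgroup p'natE // -prime_coprime // (coprime_dvdl p_dvP).
suff Q1 : Q = 1 :> {set gT} by rewrite /permutes Q1 mulg1 mul1g.
exact/card1_trivg/(pnat_1 qQ p'Q).
Qed.

End Permuting.

(** * Quotients *)

Section Quotients.

Variable gT : finGroupType.
Implicit Types G H K N : {group gT}.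

Lemma SSpermutable_quotient G N H :
    N <| G -> N \subset H -> H \subset G ->
  SSpermutable G H <-> SSpermutable (G / N) (H / N).
Proof.
move=> nsNG sNH sHG; have nNG := normal_norm nsNG.
have nNH := subset_trans sHG nNG.
split=> [[_ [K [sKG defG] permK]] | [_ [Kb [sKbG defGb] permK]]].
- split; first exact: quotientS.
  exists (K / N)%G => [|p Pb p_pr sylPb].
    by split; rewrite ?quotientS // -quotientMl // -defG.
  have nNK := subset_trans sKG nNG.
  have [P sylP] := Sylow_exists p K.
  have sylPN := quotient_pHall (subset_trans (pHall_sub sylP) nNK) sylP.
  have [_ /morphimP[x nNx Kx ->] defPb] := Sylow_trans sylPN sylPb.
  have sylPx : p.-Sylow(K) (P :^ x)%G by rewrite pHallJ.
  have nNPx := subset_trans (pHall_sub sylPx) nNK.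
  have permPx : H * P :^ x = P :^ x * H := permK p _%G p_pr sylPx.
  by rewrite /permutes defPb /= -quotientJ // -!quotientMl // permPx.
split=> //; have [K defKb sNK sKG] := inv_quotientS nsNG sKbG.
have nNK := subset_trans sKG nNG.
exists K => [|p P p_pr sylP].
  split=> //; apply/eqP; rewrite eqEsubset mul_subG // andbT.
  have : G / N \subset (H * K) / N by rewrite quotientMl // -defKb -defGb.
  by rewrite quotientSK // mulgA (mulSGid sNH).
have nNP := subset_trans (pHall_sub sylP) nNK.
have sylPN : p.-Sylow(Kb) (P / N) by rewrite defKb quotient_pHall.
have permPN : H / N * (P / N) = P / N * (H / N) := permK p (P / N)%G p_pr sylPN.
apply: permutes_sub.
have : (H * P) / N \subset (P * H) / N by rewrite !quotientMl // permPN.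
rewrite quotientSK ?mul_subG //.
by rewrite mulgA -(normC nNP) -mulgA (mulSGid sNH).
Qed.

Lemma SST_quotient G N : N <| G -> SST_group G -> SST_group (G / N).
Proof.
move=> nsNG SST_G Hb Kb sHKb sKGb.
have [K defKb sNK sKG] := inv_quotientS nsNG sKGb.
have nsNK := normalS sNK sKG nsNG.
rewrite /= defKb in sHKb *.
have [H defHb sNH sHK] := inv_quotientS nsNK sHKb.
have sHG := subset_trans sHK sKG.
have -> : Hb = (H / N)%G by apply: val_inj.
have -> : Kb = (K / N)%G by apply: val_inj.
move/(SSpermutable_quotient nsNK sNH sHK) => ssHK.
move/(SSpermutable_quotient nsNG sNK sKG) => ssKG.
exact/(SSpermutable_quotient nsNG sNH sHG)/(SST_G H K).
Qed.

End Quotients.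

(** * Groups with transitive SS-permutability *)

Section SST.

Variable gT : finGroupType.
Implicit Types G N : {group gT}.

Lemma SST_minnormal_cyclic G N :
  SST_group G -> N \subset G -> is_abelem N -> minnormal N G -> cyclic N.
Proof.
move=> SST_G sNG /is_abelemP[p p_pr abelN] /mingroupP[/andP[ntN nNG] minN].
have nsNG : N <| G by apply/andP.
have pN := abelem_pgroup abelN; have abN := abelem_abelian abelN.
have [P sylP sNP] := Sylow_superset sNG pN.
have [sPG pP _] := and3P sylP.
have ntNZ : N :&: 'Z(P) != 1.
  by rewrite meet_center_nil ?(pgroup_nil pP) // (normalS sNP sPG).
have pNZ : p.-group (N :&: 'Z(P)) := pgroupS (subsetIl _ _) pN.
have [_ pNZ_dvd _] := pgroup_pdiv pNZ ntNZ.
have [x /setIP[Nx ZPx] ox] := Cauchy p_pr pNZ_dvd.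
have sxN : <[x]> \subset N by rewrite cycle_subG.
have px : p.-group <[x]> := pgroupS sxN pN.
have ssx : SSpermutable G <[x]>.
  apply: (SST_G _ N) => //; last exact: SSpermutable_normal.
  by apply: SSpermutable_normal; rewrite -sub_abelian_normal.
have nxG : G \subset 'N(<[x]>).
  apply: subset_by_Sylow => q q_pr; have [-> | neq_qp] := eqVneq q p.
    exists P => //; apply: cents_norm.
    by rewrite centsC cycle_subG; case/setIP: ZPx.
  have [Q sylQ] := Sylow_exists q G; exists Q => //.
  have q'x : q^'.-group <[x]> by apply: pi_pnat px _; rewrite !inE eq_sym.
  have permxQ := SSpermutable_Sylow ssx q_pr q'x sylQ.
  (* Q normalises <[x]> because <[x]> = <[x]> * Q :&: N with N normal. *)
  have tiQN : Q :&: N = 1.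
    rewrite setIC coprime_TIg // (pnat_coprime pN) //.
    by apply: pi_pnat (pHall_pgroup sylQ) _; rewrite !inE.
  have defx : <[x]> = (<[x]> <*> Q) :&: N.
    by rewrite comm_joingE // -group_modl // tiQN mulg1.
  rewrite defx normsI ?(subset_trans (pHall_sub sylQ) nNG) //.
  exact: subset_trans (joing_subr _ _) (normG _).
rewrite -(minN <[x]>%G) ?cycle_cyclic //= nxG andbT.
by rewrite -cardG_gt1 -orderE ox prime_gt1.
Qed.

(** [G] acts on [N] through the abelian group [Aut N]. *)
Lemma der1_cent_cyclic_normal G N :
  N <| G -> cyclic N -> G^`(1) \subset 'C(N).
Proof.
move=> nsNG cycN; have nNG := normal_norm nsNG.
have sG'N : G^`(1) \subset 'N(N) := subset_trans (der_sub 1 G) nNG.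
rewrite -ker_conj_aut ker_trivg_morphim sG'N /=.
have abAG := abelianS (Aut_conj_aut N G) (Aut_cyclic_abelian cycN).
by rewrite morphim_der // (derG1P abAG).
Qed.

Lemma nilpotent_central_quotient (D N : {group gT}) :
  D \subset 'C(N) -> nilpotent (D / N) -> nilpotent D.
Proof.
move=> cND nilDN; have nND := cents_norm cND.
rewrite -quotient_center_nil.
have sZ : N :&: D \subset 'Z(D) by rewrite setIC setIS // centsC.
have nsND : N :&: D <| D by rewrite /normal subsetIr normsI ?normG.
rewrite -(isog_nil (third_isog sZ nsND (center_normal D))).
by rewrite quotient_nil // (isog_nil (second_isog nND)).
Qed.

End SST.

Lemma solvable_SST_der1_nil (gT : finGroupType) (G : {group gT}) :
  solvable G -> SST_group G -> nilpotent G^`(1).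
Proof.
move: {2}_.+1 (ltnSn #|G|) => n; elim: n gT G => // n IHn gT G leGn solG SST_G.
have [-> | ntG] := eqsVneq G 1.
  by rewrite (derG1P (abelian1 gT)) nilpotent1.
have [N minN sNG] := minnormal_exists ntG (normG G).
have [nNG ntN abelN] := minnormal_solvable minN sNG solG.
have nsNG : N <| G by apply/andP.
have cycN := SST_minnormal_cyclic SST_G sNG abelN minN.
apply: nilpotent_central_quotient (der1_cent_cyclic_normal nsNG cycN) _.
rewrite quotient_der //; apply: IHn; last exact: SST_quotient.
  exact: leq_trans (ltn_quotient ntN sNG) leGn.
exact: quotient_sol.
Qed.

Theorem corollary1p8 (gT : finGroupType) (G : {group gT}) :
  solvable G -> SST_group G -> BT_group G.
Proof.
move=> solG SST_G H K sHK sKG _ _.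
have nilG' := solvable_SST_der1_nil solG SST_G.
split=> [|X sXG coHX]; first exact: subset_trans sHK sKG.
apply: (coprime_permutes (G := G)) => //; last exact: subset_trans sHK sKG.
by move=> A sAG; apply: SST_SSpermutable.
Qed.
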